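(* Let $\mathcal{H}$ be a real Hilbert space, let $\alpha\in\,]0,+\infty[$, let $W\colon\mathcal{H}\to 2^{\mathcal{H}}$ be maximally monotone, let $C\colon\mathcal{H}\to\mathcal{H}$ be $\alpha$-cocoercive and such that $Z=\mathrm{zer}(W+C)\neq\varnothing$, let $x_0\in\mathcal{H}$, and let $(\lambda_n)_{n\in\mathbb{N}}$ be a sequence in $]0,2[$. Iterate, for every $n\in\mathbb{N}$: choose arbitrary $(w_n,w_n^* )\in\mathrm{gra}\,W$ and $q_n\in\mathcal{H}$, and set $$t_n^*=w_n^*+Cq_n,\qquad \delta_n=\langle x_n-w_n\mid t_n^*\rangle-\frac{\|w_n-q_n\|^2}{4\alpha},$$ $$d_n=\begin{cases}\dfrac{\delta_n}{\|t_n^*\|^2}t_n^*,&\text{if }\delta_n>0;\\ 0,&\text{otherwise,}\end{cases}\qquad x_{n+1}=x_n-\lambda_nd_n.$$ Then the following hold: (i) $(x_n)_{n\in\mathbb{N}}$ is bounded. (ii) $\sum_{n\in\mathbb{N}}\lambda_n(2-\lambda_n)\|d_n\|^2<+\infty$. (iii) Suppose that $w_n-x_n\rightharpoonup 0$, $w_n-q_n\to 0$, and $t_n^*\to 0$. Then $(x_n)_{n\in\mathbb{N}}$ converges weakly to a point in $Z$.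
   Context: For $M\colon\mathcal{H}\to2^{\mathcal{H}}$, $\mathrm{gra}\,M=\{(x,x^* )\mid x^*\in Mx\}$ and $\mathrm{zer}\,M=\{x\mid 0\in Mx\}$. $M$ is monotone if $\langle x-y\mid x^*-y^*\rangle\ge0$ for all $(x,x^* ),(y,y^* )\in\mathrm{gra}\,M$, and maximally monotone if no monotone operator has a graph strictly containing $\mathrm{gra}\,M$. $C\colon\mathcal{H}\to\mathcal{H}$ is $\alpha$-cocoercive if $\langle x-y\mid Cx-Cy\rangle\ge\alpha\|Cx-Cy\|^2$ for all $x,y$. $\rightharpoonup$ and $\to$ denote weak and strong convergence. *)

(* Defs.v *)
From HB Require Import structures.
From mathcomp Require Import all_boot all_order all_algebra.
From mathcomp Require Import all_classical all_reals all_analysis.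

Set Implicit Arguments.
Unset Strict Implicit.
Unset Printing Implicit Defensive.

Import Order.TTheory GRing.Theory Num.Theory.
Import numFieldNormedType.Exports.

Local Open Scope classical_set_scope.
Local Open Scope ring_scope.

Section SetValuedOperators.
Context {R : realType} {H : completeNormedModType R}.

(* A set-valued operator M : H -> 2^H is a function [H -> set H]. *)
Definition gra (M : H -> set H) : set (H * H) := [set p | M p.1 p.2].

Definition zer (M : H -> set H) : set H := [set x | M x 0].

Definition add_op (M N : H -> set H) : H -> set H :=
  fun x => [set a + b | a in M x & b in N x].

Definition single_op (C : H -> H) : H -> set H := fun x => [set C x].

Variable dot : {dot H for @idfun R}.

(* In a [completeNormedModType] the norm is given first; this says that it is
   the norm of the inner product, which makes [H] a real Hilbert space. *)
Definition norm_of_dot := forall x : H, `|x| ^+ 2 = dot x x.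

Definition monotone (M : H -> set H) :=
  forall x x' y y', gra M (x, x') -> gra M (y, y') ->
    0 <= dot (x - y) (x' - y').

Definition maximally_monotone (M : H -> set H) :=
  monotone M /\
  ~ exists N : H -> set H, monotone N /\ gra M `<` gra N.

Definition cocoercive (alpha : R) (C : H -> H) :=
  forall x y, alpha * `|C x - C y| ^+ 2 <= dot (x - y) (C x - C y).

(* Convergence for the coarsest topology making every [dot ^~ u] continuous. *)
Definition weakly_cvg (x : nat -> H) (l : H) :=
  forall u : H, dot (x n) u @[n --> \oo] --> dot l u.

End SetValuedOperators.

(* Main.v *)
(** Monotonicity of [W] and cocoercivity of [C] show that the half-space
    [<u - w n | t' n> <= |w n - q n|^2 / (4 alpha)] contains every zero of
    [W + C]; since [x n] is moved by a relaxed projection onto it, the sequence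
    is Fejer monotone with respect to the zeros, which gives (i), (ii) and,
    through Opial's argument, reduces (iii) to showing that weak cluster points
    are zeros. Weak cluster points are taken along ultrafilters [U] on [nat]:
    bounded sequences then converge weakly by the Riesz representation theorem.
    Let [z] and [c] be the weak limits of [w n] and [C (q n)], and [K] the limit
    of [<q n | C (q n)>]. Passing to the limit in cocoercivity and monotonicity,
    [alpha |c - C z|^2 <= K - <z | c> <= <z - y | - c - y'>] for all [(y, y')]
    in the graph of [W]. By maximality [- c] is in [W z]; taking
    [(y, y') = (z, - c)] forces [c = C z]. No surjectivity theorem of Minty type
    is needed. *)
Require Import Defs.
From HB Require Import structures.
From mathcomp Require Import all_boot all_order all_algebra.
From mathcomp Require Import all_classical all_reals all_analysis.
From mathcomp Require Import ring lra.

Set Implicit Arguments.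
Unset Strict Implicit.
Unset Printing Implicit Defensive.

Import Order.TTheory GRing.Theory Num.Theory.
Import numFieldNormedType.Exports.

Local Open Scope classical_set_scope.
Local Open Scope ring_scope.

(** * Limits of real-valued functions along ultrafilters *)

(** Compactness of [[- M, M]] gives a cluster point of the image filter, and an ultrafilter
    converges to each of its cluster points. *)
Lemma ultra_bounded_cvg (R : realType) (T : Type) (U : set_system T)
    (r : T -> R) (M : R) : UltraFilter U ->
  (forall n, `|r n| <= M) -> exists l : R, r n @[n --> U] --> l.
Proof.
move=> UU rM.
have := @segment_compact R (- M) M.
case/(_ (r @ U)).
  apply: (@filterS _ U _ setT) => [n _/=|]; last exact: filterT.
  by rewrite in_itv /= -ler_norml.
move=> l [_ clr]; exists l => B Bl.
have [//|UC] := in_ultra_setVsetC (r @^-1` B) UU.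
by have [y []] := clr (~` B) B UC Bl.
Qed.

(** If some neighbourhood [B] of [l] were not eventually reached, [\oo] restricted to the indices
    with [u n] outside [B] would be proper, and an ultrafilter refining it would contradict the
    hypothesis. *)
Lemma cvg_ultraP (R : realType) (u : nat -> R) (l : R) :
  (forall U : set_system nat, UltraFilter U -> \oo `<=` U ->
     u n @[n --> U] --> l) -> u n @[n --> \oo] --> l.
Proof.
move=> ul; apply: contrapT => nul.
have /existsNP[B /not_implyP[Bl nB]] := nul.
have FF : ProperFilter (within (~` (u @^-1` B)) \oo).
  apply: Build_ProperFilter_ex => A /= [N _ NA].
  apply: contrapT => nA; apply: nB; exists N => // n Nn /=.
  by apply: contrapT => nBn; apply: nA; exists n; apply: NA.
have [U [UU FU]] := ultraFilterLemma FF.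
have UB : U (u @^-1` B).
  apply: (ul U UU) => //; apply: subset_trans FU.
  exact: cvg_within.
have UC : U (~` (u @^-1` B)) by apply: FU; exact: withinT.
by have [n []] := filter_ex (filterI UB UC).
Qed.

(** * Inner product calculus *)

Section Hilbert.
Context {R : realType} {H : completeNormedModType R}.
Variables (dot : {dot H for @idfun R}).

Lemma dotC u v : dot u v = dot v u.
Proof. by rewrite hermC expr0 mul1r. Qed.

Lemma dotDl u v w : dot (u + v) w = dot u w + dot v w.
Proof. exact: linearDl. Qed.

Lemma dotDr u v w : dot w (u + v) = dot w u + dot w v.
Proof. by rewrite !(dotC w) dotDl. Qed.

Lemma dotZl a u v : dot (a *: u) v = a * dot u v.
Proof. exact: linearZl_LR. Qed.

Lemma dotZr a u v : dot u (a *: v) = a * dot u v.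
Proof. by rewrite !(dotC u) dotZl. Qed.

Lemma dotNl u v : dot (- u) v = - dot u v.
Proof. by rewrite -scaleN1r dotZl mulN1r. Qed.

Lemma dotNr u v : dot u (- v) = - dot u v.
Proof. by rewrite !(dotC u) dotNl. Qed.

Definition dotE := (dotDl, dotDr, dotNl, dotNr, dotZl, dotZr).

Hypothesis Hdot : norm_of_dot dot.

Lemma cauchy_schwarz u v : `|dot u v| <= `|u| * `|v|.
Proof.
have [->|v0] := eqVneq v 0.
  by rewrite linear0r !normr0 mulr0.
rewrite -ler_sqr ?nnegrE ?mulr_ge0// real_normK ?num_real//.
have vv : 0 < dot v v by rewrite -Hdot exprn_gt0// normr_gt0.
(* The component of [u] orthogonal to [v], scaled by [dot v v] to avoid a division. *)
set w := dot v v *: u - dot u v *: v.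
have ww : dot w w = dot v v * (dot u u * dot v v - dot u v ^+ 2).
  by rewrite !dotE (dotC v u); ring.
have : 0 <= dot w w by rewrite -Hdot exprn_ge0.
by rewrite ww pmulr_rge0// subr_ge0 exprMn !Hdot.
Qed.

Lemma dot_le u v : dot u v <= `|u| * `|v|.
Proof. exact: le_trans (ler_norm _) (cauchy_schwarz u v). Qed.

Lemma cvg0_dot (T : Type) (F : set_system T) (a b : T -> H) (M : R) :
  Filter F -> (forall n, `|a n| <= M) -> b n @[n --> F] --> (0 : H) ->
  dot (a n) (b n) @[n --> F] --> 0.
Proof.
move=> FF aM b0; apply: norm_cvg0.
apply: (@squeeze_cvgr _ _ _ _ (cst 0) (fun n => M * `|b n|)).
- apply: nearW => n; rewrite normr_ge0/=.
  by apply: le_trans (cauchy_schwarz _ _) _; rewrite ler_wpM2r.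
- exact: cvg_cst.
- rewrite -(mulr0 M); apply: cvgMr; rewrite -(@normr0 _ H).
  exact: cvg_norm.
Qed.

Lemma cvg_dotl (T : Type) (F : set_system T) (FF : Filter F) (a : T -> H) l u :
  a n @[n --> F] --> l -> dot (a n) u @[n --> F] --> dot l u.
Proof.
move=> al; have al0 : a n - l @[n --> F] --> (0 : H).
  by rewrite -(subrr l); apply: cvgB => //; exact: cvg_cst.
have := cvg0_dot FF (fun n : T => lexx `|u|) al0.
move=> /(cvgD (cvg_cst (dot u l))); rewrite addr0 (dotC l).
apply: cvg_trans; apply: near_eq_cvg; apply: nearW => n /=.
by rewrite fctE -dotDr addrC subrK dotC.
Qed.

(** * Weak convergence and Riesz representation *)

(** Uniform boundedness principle for the functionals [dot (a n)] on the unit ball; evaluating at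
    [a n] normalised recovers its norm. *)
Lemma weakly_cvg_bounded (a : nat -> H) l :
  weakly_cvg dot a l -> exists M, forall n, `|a n| <= M.
Proof.
move=> al.
have [f [n _ <-]||M /= HM] := @Banach_Steinhauss R H R^o
    [set (dot (a n) : H -> R^o) | n in setT] _ _ 1.
- split=> [r|k u v]; last by rewrite !dotE.
  exists (`|a n| * r) => u ur.
  by apply: le_trans (cauchy_schwarz _ _) _; rewrite ler_wpM2l.
- move=> u; have /cvg_seq_bounded[M [_ HM]] := cvgP _ (al u).
  exists (M + 1) => _ [n _ <-].
  by apply: (HM (M + 1)) => //; rewrite ltrDl.
exists M => n.
have [->|an0] := eqVneq (a n) 0.
  rewrite normr0; have := HM _ (ex_intro2 _ _ n I erefl) 0.
  by rewrite normr0 => /(_ ler01); exact: le_trans.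
have := HM _ (ex_intro2 _ _ n I erefl) (`|a n|^-1 *: a n).
rewrite normrZ normfV normr_id mulVf ?normr_eq0// => /(_ (lexx _)).
rewrite dotZr -Hdot expr2 mulrA mulVf ?normr_eq0// mul1r.
by rewrite normr_id.
Qed.

(* The representing vector minimises [|u|^2 - 2 phi u]; by the parallelogram
   identity minimising sequences are Cauchy. *)
Lemma riesz (phi : H -> R) (M : R) :
  {morph phi : u v / u + v} -> (forall a, {morph phi : u / a *: u >-> a * u}) ->
  (forall u, phi u <= M * `|u|) -> exists z, forall u, phi u = dot z u.
Proof.
move=> phiD phiZ phiM.
pose J u := dot u u - 2 * phi u.
have J_inf : has_inf (range J).
  split; first by exists (J 0), 0.
  exists (- M ^+ 2) => _ [u _ <-]; rewrite /J -Hdot.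
  by have := phiM u; have := sqr_ge0 (`|u| - M); nra.
set m := inf (range J).
have mJ u : m <= J u by apply: ge_inf; [exact: J_inf.2 | exists u].
have /choice[a Ja] n : exists u, J u < m + n.+1%:R^-1.
  have [|_ [u _ <-] ?] := @inf_adherent _ (range J) n.+1%:R^-1 _ J_inf.
    by rewrite invr_gt0.
  by exists u.
(* Parallelogram identity, with [J] evaluated at the midpoint. *)
have near_min u v : `|u - v| ^+ 2 <= 2 * (J u - m) + 2 * (J v - m).
  have := mJ (2^-1 *: (u + v)); rewrite Hdot /J phiZ phiD !dotE (dotC v u).
  lra.
have a_cvg : cvg (a n @[n --> \oo]).
  apply/cauchy_cvgP/cauchy_exP => e e0 /=.
  have e4 : 0 < e ^+ 2 / 4 by rewrite divr_gt0// exprn_gt0.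
  have [N _ Ne] := near_infty_natSinv_lt (PosNum e4).
  exists (a N); exists N => // n Nn /=; rewrite -ball_normE /=.
  rewrite -ltr_sqr ?nnegrE ?(ltW e0)//; apply: le_lt_trans (near_min _ _) _.
  have := Ne N (leqnn N); have := Ne n Nn; have := Ja N; have := Ja n.
  by rewrite /=; move: (_%:R^-1) (_%:R^-1) => p p1; lra.
pose z := lim (a n @[n --> \oo]); exists z => v.
(* Formally [J (z + t *: v) - J z]. It is obtained as a limit of the same expression at [a n], where
   minimality holds up to [n.+1%:R^-1]. *)
have variation t : 0 <= 2 * t * (dot z v - phi v) + t ^+ 2 * dot v v.
  have lim_n : (2 * t * (dot (a n) v - phi v) + t ^+ 2 * dot v v
      + n.+1%:R^-1) @[n --> \oo] -->
      2 * t * (dot z v - phi v) + t ^+ 2 * dot v v + 0.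
    apply: cvgD; last exact: cvg_harmonic.
    apply: cvgD; last exact: cvg_cst.
    apply: cvgMr; apply: cvgB; last exact: cvg_cst.
    exact: cvg_dotl.
  rewrite -[leRHS]addr0; apply: (cvgr_to_ge lim_n); apply: nearW => n.
  have := mJ (a n + t *: v); have := Ja n.
  rewrite /J phiD phiZ !dotE (dotC v (a n)).
  by move: (_%:R^-1) => p; lra.
have vv : 0 <= dot v v by rewrite -Hdot exprn_ge0.
(* The denominator [1 + dot v v] is positive even for [v = 0]. With [s = - t * (1 + b)] the
   inequality becomes [0 <= - t ^+ 2 * (2 + b)], so [t = 0]. *)
have := variation (- (dot z v - phi v) / (1 + dot v v)).
set s := dot z v - phi v; set b := dot v v in vv *; set t := _ / _ => st.
have st' : t * (1 + b) = - s by rewrite /t mulfVK//; lra.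
have t0 : t = 0.
  apply/eqP; rewrite -sqrf_eq0; apply/eqP.
  have := sqr_ge0 t; have := mulr_ge0 vv (sqr_ge0 t).
  rewrite -[s]opprK -st' in st; nra.
by apply/eqP; rewrite eq_sym -subr_eq0 -/s -[s]opprK -st' t0 mul0r oppr0.
Qed.

(** The scalar ultralimits of [dot (a n) u] depend linearly on [u] and are bounded by [M * |u|],
    hence [riesz] represents them. *)
Lemma weak_ultralimit (T : Type) (U : set_system T) (a : T -> H) (M : R) :
  UltraFilter U -> (forall n, `|a n| <= M) ->
  exists z, forall u, dot (a n) u @[n --> U] --> dot z u.
Proof.
move=> UU aM.
have au u : exists l : R, dot (a n) u @[n --> U] --> l.
  apply: (@ultra_bounded_cvg _ _ _ _ (M * `|u|)) => n.
  by apply: le_trans (cauchy_schwarz _ _) _; rewrite ler_wpM2r.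
have /choice[phi aphi] := au.
have [||u|z phiz] := @riesz phi M.
- move=> u v; apply: (cvg_unique _ (aphi _)) => //.
  by rewrite /=; under eq_cvg do rewrite dotDr; exact: cvgD.
- move=> k u; apply: (cvg_unique _ (aphi _)) => //.
  by rewrite /=; under eq_cvg do rewrite dotZr; exact: cvgMr.
- apply: (cvgr_to_le (aphi u)); apply: nearW => n.
  by apply: le_trans (dot_le _ _) _; rewrite ler_wpM2r.
- by exists z => u; rewrite -phiz.
Qed.

(** * Monotone and cocoercive operators, zeros of [W + C] *)

(** Otherwise adjoining [(u, u')] to the graph would give a strictly larger monotone operator. *)
Lemma maximally_monotone_mem (W : H -> set H) u u' :
  maximally_monotone dot W ->
  (forall y y', W y y' -> 0 <= dot (u - y) (u' - y')) -> W u u'.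
Proof.
move=> [Wmon Wmax] uW; apply: contrapT => nWu; apply: Wmax.
exists (fun a => W a `|` [set b | a = u /\ b = u']); split.
- move=> a a' b b' [/= Wa|/= [-> ->]] [/= Wb|/= [-> ->]].
  + exact: Wmon.
  + by rewrite -opprB dotNl -[a' - _]opprB dotNr opprK; exact: uW.
  + exact: uW.
  + by rewrite subrr linear0l.
- split; first by move=> [a a'] /=; left.
  by move=> /(_ (u, u')) /= sub; apply: nWu; apply: sub; right.
Qed.

Lemma cocoercive_lipschitz alpha (C : H -> H) u v : 0 < alpha ->
  cocoercive dot alpha C -> `|C u - C v| <= alpha^-1 * `|u - v|.
Proof.
move=> a0 /(_ u v) /le_trans /(_ (dot_le _ _)).
have [->|Cuv] := eqVneq (C u - C v) 0.
  by rewrite normr0 mulr_ge0// invr_ge0 ltW.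
by rewrite expr2 mulrA ler_pM2r ?normr_gt0// ler_pdivlMl.
Qed.

Section ZeroOfSum.
Variables (alpha : R) (W : H -> set H) (C : H -> H).
Hypotheses (alpha_gt0 : 0 < alpha) (W_max : maximally_monotone dot W).
Hypothesis C_coco : cocoercive dot alpha C.

Lemma zer_add_opP z : zer (add_op W (single_op C)) z <-> W z (- C z).
Proof.
split=> [[a Wa [b ->]] /eqP|Wz]; first by rewrite addr_eq0 => /eqP <-.
by exists (- C z) => //; exists (C z); rewrite ?addNr.
Qed.

Lemma zer_ultralimit (T : Type) (U : set_system T) (w w' q : T -> H) (M : R) z :
  UltraFilter U -> (forall n, W (w n) (w' n)) ->
  (forall n, `|w n| <= M) -> (forall n, `|q n| <= M) ->
  (forall u, dot (w n) u @[n --> U] --> dot z u) ->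
  w n - q n @[n --> U] --> (0 : H) ->
  w' n + C (q n) @[n --> U] --> (0 : H) ->
  zer (add_op W (single_op C)) z.
Proof.
move=> UU Www' wM qM wz wq0 t0.
have CqM n : `|C (q n)| <= `|C z| + alpha^-1 * (M + `|z|).
  rewrite -[C (q n)](subrK (C z)) addrC; apply: le_trans (ler_normD _ _) _.
  rewrite lerD2l; apply: le_trans (cocoercive_lipschitz _ _ alpha_gt0 C_coco) _.
  rewrite ler_pM2l ?invr_gt0//; apply: le_trans (ler_normB _ _) _.
  by rewrite lerD2r.
have [c Cqc] := weak_ultralimit UU CqM.
(* Both factors converge only weakly, so [K] need not be [dot z c] a priori. The difference
   [K - dot z c] is bounded below by [C_gap] and above by [W_gap]. *)
have [K qK] : exists K : R, dot (q n) (C (q n)) @[n --> U] --> K.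
  apply: (@ultra_bounded_cvg _ _ _ _ (M * (`|C z| + alpha^-1 * (M + `|z|)))).
  by move=> n; apply: le_trans (cauchy_schwarz _ _) _; exact: ler_pM.
have qz u : dot (q n) u @[n --> U] --> dot z u.
  have UF : Filter U by exact: ultra_proper.
  have wqu : dot (w n - q n) u @[n --> U] --> 0.
    by rewrite -(linear0l dot u); exact: cvg_dotl.
  have := @cvgB _ _ _ U UF _ _ _ _ (wz u) wqu; rewrite subr0.
  apply: cvg_trans; apply: near_eq_cvg; apply: nearW => n.
  by rewrite !fctE -dotNl -dotDl; congr (dot _ _); rewrite opprB addrC subrK.
have wt : dot (w n) (w' n + C (q n)) @[n --> U] --> 0 by exact: cvg0_dot.
have Cqwq : dot (C (q n)) (w n - q n) @[n --> U] --> 0 by exact: cvg0_dot.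
pose e := c - C z.
have C_gap : alpha * dot e e <= K - dot z c.
  rewrite -subr_ge0.
  (* Cocoercivity at [(q n, z)], with [|C (q n) - C z|^2] bounded below by its
     tangent at [e], which is affine in [C (q n)]. *)
  pose g n := dot (q n) (C (q n)) - dot (q n) (C z) - dot (C (q n)) z +
    dot z (C z) - alpha * (2 * (dot (C (q n)) e - dot (C z) e) - dot e e).
  have gl : g n @[n --> U] --> K - dot z (C z) - dot c z + dot z (C z) -
      alpha * (2 * (dot c e - dot (C z) e) - dot e e).
    apply: cvgB; last first.
      apply: cvgMr; apply: cvgB; last exact: cvg_cst.
      apply: cvgMr; apply: cvgB; last exact: cvg_cst.
      exact: Cqc.
    apply: cvgD; last exact: cvg_cst.
    by apply: cvgB => //; apply: cvgB.
  have : 0 <= K - dot z (C z) - dot c z + dot z (C z) -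
      alpha * (2 * (dot c e - dot (C z) e) - dot e e).
    apply: (cvgr_to_ge gl); apply: nearW => n; rewrite /g.
    have := C_coco (q n) z.
    have : 0 <= alpha * dot (C (q n) - C z - e) (C (q n) - C z - e).
      by rewrite mulr_ge0 ?(ltW alpha_gt0)// -Hdot exprn_ge0.
    rewrite Hdot !(dotDl, dotNl) !(dotDr, dotNr).
    rewrite (dotC z (C (q n))) (dotC c (C (q n))) (dotC c (C z)).
    rewrite (dotC (C z) (C (q n))).
    lra.
  rewrite /e !dotE (dotC c z) (dotC c (C z)).
  lra.
have W_gap y y' : W y y' -> K - dot z c <= dot (z - y) (- c - y').
  move=> Wy.
  (* This is [dot (w n - y) (w' n - y')], regrouped so that every product of two varying factors
     either has a strongly null factor or is [dot (q n) (C (q n))]. *)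
  have gl : (dot (w n) (w' n + C (q n)) - dot (C (q n)) (w n - q n)
      - dot (q n) (C (q n)) - dot (w n) y' - dot (w' n + C (q n)) y
      + dot (C (q n)) y + dot y y') @[n --> U] -->
      0 - 0 - K - dot z y' - dot 0 y + dot c y + dot y y'.
    apply: cvgD; last exact: cvg_cst.
    apply: cvgD => //; apply: cvgB; last exact: cvg_dotl.
    by apply: cvgB => //; apply: cvgB => //; apply: cvgB.
  have : 0 <= 0 - 0 - K - dot z y' - dot 0 y + dot c y + dot y y'.
    apply: (cvgr_to_ge gl); apply: nearW => n.
    have := W_max.1 (w n) (w' n) y y' (Www' n) Wy.
    rewrite !dotE (dotC (C (q n)) (w n)) (dotC (C (q n)) (q n)).
    rewrite (dotC (w' n) y); lra.
  rewrite linear0l !dotE (dotC c y); lra.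
have Wzc : W z (- c).
  apply: maximally_monotone_mem W_max _ => y y' /W_gap; apply: le_trans.
  apply: le_trans C_gap; rewrite mulr_ge0 ?(ltW alpha_gt0)// -Hdot exprn_ge0//.
have e0 : dot e e <= 0.
  have := W_gap _ _ Wzc; rewrite subrr linear0l => /(le_trans C_gap).
  by rewrite pmulr_rle0.
apply/zer_add_opP; suff -> : C z = c by [].
apply/esym/eqP; rewrite -subr_eq0 -/e -normr_eq0 -sqrf_eq0 Hdot.
by rewrite eq_le e0 -Hdot exprn_ge0.
Qed.

(** With [u = C q - C z], monotonicity and cocoercivity bound the left side by
    [- dot (w - q) u - alpha * |u| ^+ 2]; completing the square gives the constant [4 * alpha]. *)
Lemma zer_halfspace z w w' q : zer (add_op W (single_op C)) z -> W w w' ->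
  dot (z - w) (w' + C q) <= `|w - q| ^+ 2 / (4 * alpha).
Proof.
move=> /zer_add_opP Wz Ww.
have := W_max.1 _ _ _ _ Ww Wz; have := C_coco q z.
rewrite ler_pdivlMr ?mulr_gt0// opprK.
have : 0 <= dot (w - q + (2 * alpha) *: (C q - C z))
    (w - q + (2 * alpha) *: (C q - C z)).
  by rewrite -Hdot exprn_ge0.
set u := C q - C z => sq coco mono.
have -> : dot (z - w) (w' + C q) =
    - dot (w - z) (w' + C z) - dot (w - q) u - dot (q - z) u.
  by rewrite /u !dotE; ring.
move: sq coco mono; rewrite !Hdot !(dotDl (w - q)) !(dotDr (w - q)).
rewrite !(dotZl, dotZr).
rewrite (dotC u (w - q)).
move: (dot (w - q) u) (dot (q - z) u) (dot (w - z) _) (dot u u) (dot (w - q) _).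
move=> a b e f g.
move=> sq; rewrite -subr_ge0 => /(mulr_ge0 (ltW alpha_gt0)) coco.
move=> /(mulr_ge0 (ltW alpha_gt0)); lra.
Qed.

End ZeroOfSum.

(** * Relaxed projections and Opial's lemma *)

(** The key inequality is [|d| ^+ 2 <= dot (x - z) d]; the claim follows by expanding the square. *)
Lemma relaxed_projection_step (x z t d : H) (delta lambda : R) :
  0 < lambda -> delta <= dot (x - z) t ->
  d = (if 0 < delta then (delta / `|t| ^+ 2) *: t else 0) ->
  `|x - lambda *: d - z| ^+ 2 <=
    `|x - z| ^+ 2 - lambda * (2 - lambda) * `|d| ^+ 2.
Proof.
move=> l0 dt dE.
have : `|d| ^+ 2 <= dot (x - z) d.
  rewrite dE; case: ifPn => [d0|_]; last by rewrite normr0 expr0n linear0r.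
  (* Division by zero is harmless here: the quotient multiplies [t = 0]. *)
  have [->|t0] := eqVneq t 0; first by rewrite scaler0 normr0 expr0n linear0r.
  have k0 : 0 < delta / `|t| ^+ 2 by rewrite divr_gt0// exprn_gt0// normr_gt0.
  rewrite dotZr normrZ (gtr0_norm k0) exprMn expr2 -mulrA ler_pM2l//.
  by rewrite mulfVK// sqrf_eq0 normr_eq0.
rewrite addrAC !Hdot !(dotDl (x - z)) !(dotDr (x - z)) !dotNl !dotNr.
rewrite !(dotZl, dotZr) (dotC d (x - z)).
nra.
Qed.

(** For weak cluster points [z] and [z'], both in [Z], polarisation makes [dot (x n) (z - z')]
    converge along [\oo]. Its limits along the two ultrafilters thus agree, which says
    [dot (z - z') (z - z') = 0]. Any [U0] refining [\oo] supplies the candidate limit. *)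
Lemma opial (x : nat -> H) (M : R) (Z : set H) :
  (forall n, `|x n| <= M) ->
  (forall z, Z z -> cvg (`|x n - z| ^+ 2 @[n --> \oo])) ->
  (forall U : set_system nat, UltraFilter U -> \oo `<=` U ->
    forall z, (forall u, dot (x n) u @[n --> U] --> dot z u) -> Z z) ->
  exists z, Z z /\ weakly_cvg dot x z.
Proof.
move=> xM xZ clZ.
have cvg_diff a b : Z a -> Z b -> cvg (dot (x n) (a - b) @[n --> \oo]).
  move=> Za Zb.
  have -> : (fun n => dot (x n) (a - b)) = (fun n =>
      2^-1 * (`|x n - b| ^+ 2 - `|x n - a| ^+ 2 + (dot a a - dot b b))).
    apply/funext => n.
    by rewrite !Hdot !dotE (dotC a (x n)) (dotC b (x n)); lra.
  apply: is_cvgMr; apply: is_cvgD; last exact: is_cvg_cst.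
  by apply: is_cvgB; exact: xZ.
have [U0 [UU0 ooU0]] := ultraFilterLemma (eventually_filter).
have [z xz] := weak_ultralimit UU0 xM.
have Zz := clZ _ UU0 ooU0 _ xz.
exists z; split=> // u; apply: cvg_ultraP => U UU ooU.
have [z' xz'] := weak_ultralimit UU xM.
have Zz' := clZ _ UU ooU _ xz'.
suff -> : z = z' by exact: xz'.
have lim_eq V v : UltraFilter V -> \oo `<=` V ->
    (forall u, dot (x n) u @[n --> V] --> dot v u) ->
    dot v (z - z') = lim (dot (x n) (z - z') @[n --> \oo]).
  move=> UV ooV xv; apply: (cvg_unique _ (xv _)) => //.
  by apply: cvg_trans (cvg_diff _ _ Zz Zz'); exact: cvg_app.
apply/eqP; rewrite -subr_eq0 -normr_eq0 -sqrf_eq0 Hdot dotDl dotNl.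
by rewrite (lim_eq _ _ UU0 ooU0 xz) (lim_eq _ _ UU ooU xz') subrr.
Qed.

End Hilbert.

(** * Fejér monotonicity of the iteration and its consequences *)

Theorem theorem4p8 (R : realType) (H : completeNormedModType R)
    (dot : {dot H for @idfun R}) (Hdot : norm_of_dot dot)
    (alpha : R) (alpha_gt0 : 0 < alpha)
    (W : H -> set H) (W_max : maximally_monotone dot W)
    (C : H -> H) (C_coco : cocoercive dot alpha C)
    (Z_neq0 : zer (add_op W (single_op C)) !=set0)
    (x0 : H) (lambda : nat -> R) (lambda02 : forall n, 0 < lambda n < 2)
    (x w w' q t' d : nat -> H) (delta : nat -> R)
    (x_0 : x 0%N = x0)
    (ww'_W : forall n, gra W (w n, w' n))
    (t'E : forall n, t' n = w' n + C (q n))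
    (deltaE : forall n,
       delta n = dot (x n - w n) (t' n) - `|w n - q n| ^+ 2 / (4 * alpha))
    (dE : forall n,
       d n = if 0 < delta n then (delta n / `|t' n| ^+ 2) *: t' n else 0)
    (xS : forall n, x n.+1 = x n - lambda n *: d n) :
  [/\ bounded_set (range x),
      (\sum_(0 <= n <oo) (lambda n * (2 - lambda n) * `|d n| ^+ 2)%:E < +oo)%E
    & weakly_cvg dot (fun n => w n - x n) 0 ->
      (w n - q n) @[n --> \oo] --> (0 : H) ->
      t' n @[n --> \oo] --> (0 : H) ->
      exists z, zer (add_op W (single_op C)) z /\ weakly_cvg dot x z].
Proof.
pose Z := zer (add_op W (single_op C)).
have l0 n : 0 < lambda n by case/andP: (lambda02 n).
pose s n := lambda n * (2 - lambda n) * `|d n| ^+ 2.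
have s0 n : 0 <= s n.
  case/andP: (lambda02 n) => ? ?.
  by rewrite /s mulr_ge0 ?exprn_ge0// mulr_ge0// ltW// subr_gt0.
(* Splitting [x n - z] at [w n], the half-space inequality gives
   [delta n <= dot (x n - z) (t' n)]. *)
have fejer z n : Z z -> `|x n.+1 - z| ^+ 2 <= `|x n - z| ^+ 2 - s n.
  move=> Zz; rewrite xS; apply: (relaxed_projection_step Hdot (l0 n) _ (dE n)).
  have := zer_halfspace Hdot alpha_gt0 W_max C_coco (q n) Zz (ww'_W n).
  rewrite -t'E deltaE /= !dotDl !dotNl; lra.
have x_ni z : Z z -> nonincreasing_seq (fun n => `|x n - z| ^+ 2).
  move=> Zz; apply/nonincreasing_seqP => n.
  by apply: le_trans (fejer _ _ Zz) _; rewrite gerBl.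
have [z0 Zz0] := Z_neq0.
have xM n : `|x n| <= `|x 0 - z0| + `|z0|.
  rewrite -[x n](subrK z0); apply: le_trans (ler_normD _ _) _; rewrite lerD2r.
  by rewrite -ler_sqr ?nnegrE//; exact: x_ni.
split.
- exists (`|x 0 - z0| + `|z0|); split; first exact: num_real.
  by move=> M /ltW xMM _ [n _ <-]; exact: le_trans xMM.
- apply: le_lt_trans (ltry (`|x 0 - z0| ^+ 2)).
  apply: lime_le.
    by apply: is_cvg_nneseries => n _ _; rewrite lee_fin; exact: s0.
  apply: nearW => N; rewrite sumEFin lee_fin.
  (* Telescoping of the Fejér inequality. *)
  have : \sum_(0 <= n < N) s n <= `|x 0 - z0| ^+ 2 - `|x N - z0| ^+ 2.
    elim: N => [|N IH]; first by rewrite big_geq// subrr.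
    by rewrite big_nat_recr//=; have := fejer z0 N Zz0; lra.
  by move=> /le_trans; apply; rewrite gerBl exprn_ge0.
- move=> wx wq t0.
  have [M1 wxM] := weakly_cvg_bounded Hdot wx.
  have [M2 [_ wqM]] := cvg_seq_bounded (cvgP _ wq).
  set M0 := `|x 0 - z0| + `|z0| in xM.
  have wM n : `|w n| <= M0 + M1.
    by rewrite -[w n](subrK (x n)) addrC (le_trans (ler_normD _ _))// lerD.
  (* Only numbers strictly above [M2] are known to be bounds; [|M2| + 1] is one, and its sign lets
     the bound on [q n] also serve for [w n]. *)
  have wqM' n : `|w n - q n| <= `|M2| + 1.
    by apply: (wqM (`|M2| + 1)) => //; rewrite ltr_pwDr// ler_norm.
  have qM n : `|q n| <= M0 + M1 + (`|M2| + 1).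
    by rewrite -[q n](subKr (w n)) (le_trans (ler_normB _ _))// lerD.
  apply: (opial Hdot xM) => [z Zz|U UU ooU z xz].
    apply: nonincreasing_is_cvgn; first exact: x_ni.
    by exists 0 => _ [n _ <-]; rewrite exprn_ge0.
  apply: (zer_ultralimit Hdot alpha_gt0 W_max C_coco UU (w' := w') _ _ qM).
  + exact: ww'_W.
  + by move=> n; apply: le_trans (wM n) _; rewrite lerDl addr_ge0.
  (* As [w n - x n] is weakly null, [w] inherits the weak limit of [x] along [U]. *)
  + move=> u; have UF : Filter U by exact: ultra_proper.
    have wxu : dot (w n - x n) u @[n --> U] --> 0.
      by have := wx u; rewrite linear0l; apply: cvg_trans; exact: cvg_app.
    have := @cvgD _ _ _ U UF _ _ _ _ (xz u) wxu; rewrite addr0.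
    apply: cvg_trans; apply: near_eq_cvg; apply: nearW => n.
    by rewrite !fctE -dotDl addrC subrK.
  + by apply: cvg_trans wq; exact: cvg_app.
  + under eq_cvg do rewrite -t'E.
    by apply: cvg_trans t0; exact: cvg_app.
Qed.
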